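(* Let $n$ and $N$ be positive integers. Then the ring $\partial^{-N}A_{\mathrm{r}}=\{f\in\partial^{-N}A : f(z)=\overline{f(\overline{z})} \text{ for all } z\in\overline{\mathbb{D}}^n\}$, with pointwise operations, is a projective free ring.
   Context: $\mathbb{D}^n:=\{z=(z_1,\dots,z_n)\in\mathbb{C}^n : |z_j|<1,\ j=1,\dots,n\}$ is the open polydisc and $\overline{\mathbb{D}}^n$ is its closure in $\mathbb{C}^n$. For $z=(z_1,\dots,z_n)\in\mathbb{C}^n$, $\overline{z}:=(\overline{z_1},\dots,\overline{z_n})$ denotes componentwise complex conjugation. $A$ denotes the polydisc algebra: the set of all continuous functions $f:\overline{\mathbb{D}}^n\to\mathbb{C}$ that are holomorphic in $\mathbb{D}^n$, with pointwise operations. For a positive integer $N$, $\partial^{-N}A$ denotes the algebra of all functions $f\in A$ whose complex partial derivatives $\frac{\partial^{\alpha_1+\dots+\alpha_n}f}{\partial z_1^{\alpha_1}\cdots\partial z_n^{\alpha_n}}$ of all orders $\alpha_1+\dots+\alpha_n\le N$ belong to $A$ (that is, these derivatives, defined on $\mathbb{D}^n$, extend continuously to $\overline{\mathbb{D}}^n$). A commutative ring $R$ with identity is called projective free if every finitely generated projective $R$-module is free. Here a finitely generated $R$-module $M$ is free if $M\simeq R^k$ for some integer $k\ge 0$, and projective if there exist an $R$-module $L$ and an integer $m\ge 0$ such that $M\oplus L\simeq R^m$. *)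

(* Defs.v *)
From HB Require Import structures.
From mathcomp Require Import all_boot all_order all_algebra.
From mathcomp Require Import complex.
From mathcomp Require Import all_classical all_reals all_analysis.

Set Implicit Arguments.
Unset Strict Implicit.
Unset Printing Implicit Defensive.

Import Order.TTheory GRing.Theory Num.Theory numFieldNormedType.Exports.

Local Open Scope classical_set_scope.
Local Open Scope ring_scope.

Section ProjectiveFree.
Variable R : comPzRingType.

Definition linear_iso (M L : lmodType R) : Prop :=
  exists f : {linear M -> L}, bijective f.

Definition finitely_generated (M : lmodType R) : Prop :=
  exists (k : nat) (e : 'I_k -> M),
    forall x, exists c : 'I_k -> R, x = \sum_(i < k) c i *: e i.

Definition free_module (M : lmodType R) : Prop :=
  exists k : nat, linear_iso M 'rV[R]_k.

Definition projective_module (M : lmodType R) : Prop :=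
  exists (L : lmodType R) (m : nat), linear_iso (M * L)%type 'rV[R]_m.

Definition projective_free : Prop :=
  forall M : lmodType R,
    finitely_generated M -> projective_module M -> free_module M.

End ProjectiveFree.

(* The complex numbers are packed as a [numClosedFieldType] because the
   library derives the topology and the norm from that structure and has no
   such instance on [R[i]] itself. *)
Definition Cplx (R : realType) : numClosedFieldType := R[i]%C.

Lemma foldr_iter (I T : Type) (f : I -> T -> T) (a : I -> nat) (x : T) s :
  foldr (fun j y => iter (a j) (f j) y) x s =
  foldr f x (flatten [seq nseq (a j) j | j <- s]).
Proof.
elim: s => //= j s ->.
by rewrite foldr_cat; elim: (a j) => //= k ->.
Qed.

Section Polydisc.
Variables (R : realType) (n : nat).
Local Notation C := (Cplx R).

Definition polydisc : set 'rV[C]_n := [set z | forall j, `|z 0 j| < 1].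

Definition cpolydisc : set 'rV[C]_n := closure polydisc.

Definition conj_rV (z : 'rV[C]_n) : 'rV[C]_n := \row_j (z 0 j)^*.

Lemma conj_polydisc z : polydisc z -> polydisc (conj_rV z).
Proof. by move=> Dz j; rewrite mxE norm_conjC. Qed.

Lemma conj_rVK : involutive conj_rV.
Proof. by move=> z; apply/rowP => j; rewrite !mxE conjCK. Qed.

Lemma conj_cpolydisc z : cpolydisc z -> cpolydisc (conj_rV z).
Proof.
move=> cz B /nbhs_ballP [e e0 eB].
have [w [Dw [_ zw]]] := cz _ (nbhsx_ballx z e e0).
exists (conj_rV w); split; first exact: conj_polydisc.
apply: eB; split=> // i j; move: (zw i j).
by rewrite -!ball_normE /ball_ /= !mxE !ord1 -rmorphB norm_conjC.
Qed.

Definition cpolydisc_conj (z : cpolydisc) : cpolydisc :=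
  SigSub (mem_set (conj_cpolydisc (set_valP z))).

(* Differentiability and derivatives at points of the open polydisc only depend
   on values there; [ext0 f] merely makes [f] total, being 0 off the closed
   polydisc. *)
Definition ext0 (f : cpolydisc -> C) : 'rV[C]_n -> C := valL_ 0 f.

Definition holomorphic (g : 'rV[C]_n -> C) : Prop :=
  forall z, polydisc z -> differentiable g z.

Definition polydisc_algebra (f : cpolydisc -> C) : Prop :=
  continuous f /\ holomorphic (ext0 f).

Definition partial (j : 'I_n) (g : 'rV[C]_n -> C) : 'rV[C]_n -> C :=
  fun z => 'D_(delta_mx 0 j) g z.

Definition multi_partial (alpha : 'I_n -> nat) (g : 'rV[C]_n -> C) :
    'rV[C]_n -> C :=
  foldr (fun j h => iter (alpha j) (partial j) h) g (enum 'I_n).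

Definition extends_in_algebra (h : 'rV[C]_n -> C) : Prop :=
  exists2 g : cpolydisc -> C,
    polydisc_algebra g & forall z, polydisc z -> h z = ext0 g z.

(* ['D_v] is total; since the derivatives of lower order are required to be
   holomorphic, every derivative occurring here does exist. *)
Definition dN_algebra (N : nat) (f : cpolydisc -> C) : Prop :=
  polydisc_algebra f /\
  forall alpha : 'I_n -> nat, (\sum_j alpha j <= N)%N ->
    extends_in_algebra (multi_partial alpha (ext0 f)).

Definition real_symmetric (f : cpolydisc -> C) : Prop :=
  forall z, f z = (f (cpolydisc_conj z))^*.

Definition dN_algebra_real (N : nat) : pred (cpolydisc -> C) :=
  fun f => `[< dN_algebra N f /\ real_symmetric f >].

Lemma open_polydisc : open polydisc.
Proof.
suff -> : polydisc = ball (0 : 'rV[C]_n) 1 by exact: ball_open.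
apply/seteqP; split=> z.
  move=> Dz; split=> // i j.
  by rewrite -ball_normE /ball_ /= mxE sub0r normrN ord1.
move=> [_ Dz] j; move: (Dz 0 j).
by rewrite -ball_normE /ball_ /= mxE sub0r normrN.
Qed.

Lemma near_polydisc z : polydisc z -> \forall w \near z, polydisc w.
Proof. by move=> Dz; apply: open_nbhs_nbhs; split=> //; exact: open_polydisc. Qed.

Lemma ext0E f (z : cpolydisc) : ext0 f (val z) = f z.
Proof. by rewrite /ext0 /valL_ /= oinv_set_val valK. Qed.

Lemma ext0_out f z : ~ cpolydisc z -> ext0 f z = 0.
Proof.
move=> Nz; rewrite /ext0 /valL_ /= oinv_set_val insubN//.
by apply/negP => /set_mem.
Qed.

Lemma ext0_ind (P : C -> C -> C -> Prop) (f g h : cpolydisc -> C) z :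
  P 0 0 0 -> (forall z, P (f z) (g z) (h z)) ->
  P (ext0 f z) (ext0 g z) (ext0 h z).
Proof.
move=> P0 Pz; have [zD|zD] := pselect (cpolydisc z); last by rewrite !ext0_out.
by rewrite -[z]/(val (SigSub (mem_set zD) : cpolydisc)) !ext0E.
Qed.

Lemma ext0B f g : ext0 (f - g) = ext0 f - ext0 g.
Proof.
apply/funext => z; apply: (@ext0_ind (fun a b c => a = b - c)) => //.
by rewrite subr0.
Qed.

Lemma ext0M f g : ext0 (f * g) = ext0 f * ext0 g.
Proof.
apply/funext => z; apply: (@ext0_ind (fun a b c => a = b * c)) => //.
by rewrite mulr0.
Qed.

Lemma ext0_cst c z : polydisc z -> ext0 (cst c) z = c.
Proof.
move=> /subset_closure zD.
by rewrite -[z]/(val (SigSub (mem_set zD) : cpolydisc)) ext0E.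
Qed.

Lemma near_eq_differentiable (g h : 'rV[C]_n -> C) z :
  (\forall w \near z, g w = h w) -> differentiable g z -> differentiable h z.
Proof.
move=> gh dg; have gz : g z = h z by exact: nbhs_singleton gh.
have cg : continuous ('d g z) by exact: diff_continuous.
have eg := diff_locally dg.
have eh : h \o shift z = cst (h z) + 'd g z +o_ 0 id.
  apply/eqaddoP => e e0; move/eqaddoP: eg => /(_ e e0).
  have : \forall w \near 0, g (w + z) = h (w + z).
    have := near_shift 0 z (fun w => g w = h w).
    by rewrite /= subr0 => <-.
  apply: filterS2 => w /= gw.
  by rewrite !fctE /= gw gz.
apply/diff_locallyP; have -> : 'd h z = 'd g z :> (_ -> _) by exact: diff_unique.
by split.
Qed.

Lemma extends_diff h : extends_in_algebra h -> holomorphic h.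
Proof.
move=> [g [_ dg] hg] z Dz; apply: near_eq_differentiable (dg z Dz).
by apply: filterS (near_polydisc Dz) => w /hg.
Qed.

Lemma extends_eq h k : (forall z, polydisc z -> h z = k z) ->
  extends_in_algebra h -> extends_in_algebra k.
Proof. by move=> hk [g Ag hg]; exists g => // z Dz; rewrite -hk // hg. Qed.

Lemma polydisc_algebra_cst c : polydisc_algebra (cst c).
Proof.
split=> [|z Dz]; first exact: cst_continuous.
apply: (@near_eq_differentiable (cst c)); last exact: differentiable_cst.
by apply: filterS (near_polydisc Dz) => w Dw; rewrite ext0_cst.
Qed.

Lemma polydisc_algebraB f g :
  polydisc_algebra f -> polydisc_algebra g -> polydisc_algebra (f - g).
Proof.
move=> [cf df] [cg dg]; split=> [z|z Dz].
  by apply: continuousB; [exact: cf|exact: cg].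
by rewrite ext0B; apply: differentiableB; [exact: df|exact: dg].
Qed.

Lemma polydisc_algebraM f g :
  polydisc_algebra f -> polydisc_algebra g -> polydisc_algebra (f * g).
Proof.
move=> [cf df] [cg dg]; split=> [z|z Dz].
  by apply: continuousM; [exact: cf|exact: cg].
by rewrite ext0M; apply: differentiableM; [exact: df|exact: dg].
Qed.

Lemma extends_cst c : extends_in_algebra (cst c).
Proof.
by exists (cst c) => [|z Dz]; [exact: polydisc_algebra_cst|rewrite ext0_cst].
Qed.

Lemma extendsB h k : extends_in_algebra h -> extends_in_algebra k ->
  extends_in_algebra (h - k).
Proof.
move=> [f Af hf] [g Ag kg]; exists (f - g); first exact: polydisc_algebraB.
by move=> z Dz; rewrite ext0B !fctE hf // kg.
Qed.

Lemma extendsM h k : extends_in_algebra h -> extends_in_algebra k ->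
  extends_in_algebra (h * k).
Proof.
move=> [f Af hf] [g Ag kg]; exists (f * g); first exact: polydisc_algebraM.
by move=> z Dz; rewrite ext0M !fctE hf // kg.
Qed.

Let dw (u : seq 'I_n) (h : 'rV[C]_n -> C) := foldl (fun g j => partial j g) h u.

Let good w h := forall u, subseq u w -> extends_in_algebra (dw u h).

Lemma eq_partial j g h : (forall z, polydisc z -> g z = h z) ->
  forall z, polydisc z -> partial j g z = partial j h z.
Proof.
move=> gh z Dz; apply: near_eq_derive.
by apply: filterS (near_polydisc Dz) => w /gh.
Qed.

Let eq_dw u g h : (forall z, polydisc z -> g z = h z) ->
  forall z, polydisc z -> dw u g z = dw u h z.
Proof.
elim: u g h => [|j u IH] g h gh; first exact: gh.
exact: (IH (partial j g) (partial j h) (eq_partial j gh)).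
Qed.

Let eq_good w g h : (forall z, polydisc z -> g z = h z) -> good w g -> good w h.
Proof.
move=> gh Gg u uw; have [k Ak gk] := Gg u uw; exists k => // z Dz.
by rewrite -gk //; apply/esym/eq_dw.
Qed.

Let good_cons j w h : good (j :: w) h <-> good w h /\ good w (partial j h).
Proof.
split=> [G|[G1 G2] [|i u]].
- split=> u uw; first by apply: G; apply: subseq_trans uw (subseq_cons _ _).
  by apply: (G (j :: u)); rewrite /= eqxx.
- by move=> _; apply: (G1 [::]); exact: sub0seq.
- rewrite /=; case: eqP => [->|_] uw; first exact: (G2 u).
  exact: (G1 (i :: u)).
Qed.

Let good_nil w h : good w h -> extends_in_algebra h.
Proof. by move=> /(_ [::] (sub0seq _)). Qed.

Let good0 h : extends_in_algebra h -> good [::] h.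
Proof. by move=> Eh u; rewrite subseq0 => /eqP ->. Qed.

Lemma partialB j g h : holomorphic g -> holomorphic h ->
  forall z, polydisc z -> (partial j g - partial j h) z = partial j (g - h) z.
Proof.
move=> dg dh z Dz; rewrite /partial deriveB //.
- by apply: diff_derivable; exact: dg.
- by apply: diff_derivable; exact: dh.
Qed.

Lemma partialM j g h : holomorphic g -> holomorphic h ->
  forall z, polydisc z ->
    (g * partial j h + h * partial j g) z = partial j (g * h) z.
Proof.
move=> dg dh z Dz; rewrite /partial deriveM //.
- by apply: diff_derivable; exact: dg.
- by apply: diff_derivable; exact: dh.
Qed.

Let good_cst w c : good w (cst c).
Proof.
elim: w c => [|j w IH] c; first exact/good0/extends_cst.
apply/good_cons; split=> //.
suff -> : partial j (cst c) = cst 0 by [].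
by apply/funext => z; exact: derive_cst.
Qed.

Let goodB w g h : good w g -> good w h -> good w (g - h).
Proof.
elim: w g h => [|j w IH] g h.
  by move=> /good_nil Eg /good_nil Eh; exact/good0/extendsB.
move=> /good_cons[Gg Gg'] /good_cons[Gh Gh']; apply/good_cons; split.
  exact: IH.
apply: eq_good (IH _ _ Gg' Gh'); apply: partialB; apply: extends_diff.
  exact: good_nil Gg.
exact: good_nil Gh.
Qed.

Let goodD w g h : good w g -> good w h -> good w (g + h).
Proof.
move=> Gg Gh; have -> : g + h = g - (cst 0 - h).
  by apply/funext => z; rewrite !fctE sub0r opprK.
by apply: goodB => //; exact: goodB.
Qed.

Let goodM w g h : good w g -> good w h -> good w (g * h).
Proof.
elim: w g h => [|j w IH] g h.
  by move=> /good_nil Eg /good_nil Eh; exact/good0/extendsM.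
move=> /good_cons[Gg Gg'] /good_cons[Gh Gh']; apply/good_cons; split.
  exact: IH.
apply: eq_good (goodD (IH _ _ Gg Gh') (IH _ _ Gh Gg')).
apply: partialM; apply: extends_diff.
  exact: good_nil Gg.
exact: good_nil Gh.
Qed.

Let word (s : seq 'I_n) (a : 'I_n -> nat) := flatten [seq nseq (a j) j | j <- s].

Let word_eq s a b : {in s, a =1 b} -> word s a = word s b.
Proof.
move=> ab; rewrite /word; congr flatten.
by apply/eq_in_map => j js; rewrite ab.
Qed.

Let subseq_word s a u : uniq s -> subseq u (word s a) ->
  exists b, u = word s b.
Proof.
elim: s u => [|j s IH] u /=.
  by case: u => // _ _; exists (fun=> 0%N).
move=> /andP[js us] /subseqP[m]; rewrite /word /= size_cat size_nseq => sm ->.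
rewrite -(cat_take_drop (a j) m) mask_cat; last first.
  by rewrite size_nseq size_takel // sm leq_addr.
have [b ->] := IH _ us (mask_subseq (drop (a j) m) (word s a)).
set v := mask _ (nseq _ _).
have /all_pred1P -> : all (pred1 j) v.
  by apply/allP => i /mem_mask; rewrite mem_nseq => /andP[_ /eqP->] /=.
exists (fun i => if i == j then size v else b i) => /=.
rewrite /word /= eqxx; congr (_ ++ _).
by apply: word_eq => i si; case: eqP => // ij; rewrite -ij si in js.
Qed.

Let size_word a : size (word (enum 'I_n) a) = (\sum_j a j)%N.
Proof.
rewrite /word size_flatten /shape -map_comp sumnE big_map big_enum /=.
by apply: eq_bigr => j _; rewrite size_nseq.
Qed.

Let multi_partialE a h : multi_partial a h = dw (rev (word (enum 'I_n) a)) h.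
Proof.
rewrite /multi_partial /dw foldl_rev /word.
exact: (foldr_iter partial).
Qed.

Let dN_algebraP N f : dN_algebra N f <->
  polydisc_algebra f /\ forall a : 'I_n -> nat, (\sum_j a j <= N)%N ->
    good (rev (word (enum 'I_n) a)) (ext0 f).
Proof.
split=> -[Af E]; split=> // a aN.
  move=> u; rewrite -{1}[u]revK subseq_rev => sub.
  have [b ub] := subseq_word (enum_uniq _) sub.
  have := E b; rewrite multi_partialE -ub revK; apply.
  rewrite -size_word -ub; apply: leq_trans aN.
  by rewrite -size_word; exact: size_subseq.
by rewrite multi_partialE; exact: (E a aN _ (subseq_refl _)).
Qed.

Lemma dN_algebra_real_subring N : subring_closed (dN_algebra_real N).
Proof.
split.
- apply/asboolP; split; last by move=> z; exact: (esym (conjC1 C)).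
  apply/dN_algebraP; split=> [|a _]; first exact: polydisc_algebra_cst.
  have E z : polydisc z -> cst 1 z = ext0 1 z by move=> Dz; rewrite ext0_cst.
  exact: (eq_good E (@good_cst _ 1)).
- move=> f g /asboolP[/dN_algebraP[Af Gf] rf] /asboolP[/dN_algebraP[Ag Gg] rg].
  apply/asboolP; split; last by move=> z; rewrite !fctE rf rg rmorphB.
  apply/dN_algebraP; split=> [|a aN]; first exact: polydisc_algebraB.
  by rewrite ext0B; apply: goodB; [exact: Gf|exact: Gg].
- move=> f g /asboolP[/dN_algebraP[Af Gf] rf] /asboolP[/dN_algebraP[Ag Gg] rg].
  apply/asboolP; split; last by move=> z; rewrite !fctE rf rg rmorphM.
  apply/dN_algebraP; split=> [|a aN]; first exact: polydisc_algebraM.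
  by rewrite ext0M; apply: goodM; [exact: Gf|exact: Gg].
Qed.

End Polydisc.

Arguments polydisc : clear implicits.
Arguments cpolydisc : clear implicits.
Arguments dN_algebra_real : clear implicits.

Record dN_ring (R : realType) (n N : nat) := DNRing {
  dN_fun :> cpolydisc R n -> Cplx R;
  dN_funP : dN_fun \in dN_algebra_real R n N
}.

Section DNRingStructure.
Variables (R : realType) (n N : nat).

HB.instance Definition _ := [isSub for @dN_fun R n N].
HB.instance Definition _ := [Choice of dN_ring R n N by <:].
HB.instance Definition _ :=
  GRing.SubChoice_isSubComPzRing.Build (cpolydisc R n -> Cplx R)
    (dN_algebra_real R n N) (dN_ring R n N)
    (@dN_algebra_real_subring R n N).

End DNRingStructure.

(* Main.v *)
(* A finitely generated projective module is the image of an idempotent matrix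
   P over the ring.  Along the dilations P_t(z) = P(t z), 0 <= t <= 1, P is
   joined to the constant real idempotent P_0, whose image is free by linear
   algebra.  For idempotents P and Q, the matrix W = P Q + (1 - P)(1 - Q)
   satisfies P W = W Q and equals 1 when P = Q; by compactness of the closed
   polydisc, det W(z) has no zero when P = P_s, Q = P_t and |s - t| is small.
   A nowhere vanishing element of the ring is invertible, so P_s and P_t are
   then similar, and finitely many such steps lead from P_0 to P = P_1. *)

Require Import Defs.
From HB Require Import structures.
From mathcomp Require Import all_boot all_order all_algebra all_reals.
From mathcomp Require Import complex.
From mathcomp Require Import all_classical all_analysis.

Set Implicit Arguments.
Unset Strict Implicit.
Unset Printing Implicit Defensive.

Import Order.TTheory GRing.Theory Num.Theory numFieldNormedType.Exports.
Local Open Scope classical_set_scope.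
Local Open Scope ring_scope.

(** * Idempotent matrices and projective modules *)

Definition splits (A : pzSemiRingType) m (P : 'M[A]_m) :=
  exists r (X : 'M[A]_(m, r)) (Y : 'M[A]_(r, m)), P = X *m Y /\ Y *m X = 1%:M.

(** The projection of M + L onto M, read in A^m through [f] and [g], is an idempotent matrix. Once
    it is factored as X Y with Y X = 1, embedding M in A^m and multiplying by X is inverse to
    multiplying by Y and projecting to M. *)
Lemma splits_projective_free (A : comPzRingType) :
  (forall m (P : 'M[A]_m), P *m P = P -> splits P) -> projective_free A.
Proof.
move=> spl M _ [L [m [f [g fK gK]]]].
have gL : linear g := can2_linear fK gK.
pose gl : {linear _ -> _} := HB.pack g (GRing.isLinear.Build _ _ _ _ g gL).
pose i (x : M) : (M * L)%type := (x, 0).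
have iL : linear i.
  move=> a u v.
  suff : (a *: u + v, 0) = (a *: u + v, a *: 0 + 0) :> M * L by [].
  by rewrite scaler0 addr0.
pose il : {linear M -> (M * L)%type} :=
  HB.pack i (GRing.isLinear.Build _ _ _ _ i iL).
pose p : {linear 'rV[A]_m -> 'rV[A]_m} := f \o il \o fst \o gl.
have pE v : v *m lin1_mx p = f (i (g v).1) by rewrite mul_rV_lin1.
have [|r [X [Y [PE YX]]]] := spl m (lin1_mx p).
  by apply/row_matrixP => j; rewrite row_mul rowE !pE fK.
pose h : {linear M -> 'rV[A]_r} := mulmxr X \o f \o il.
exists r, h, (fun y => (g (y *m Y)).1) => [x|y] /=.
  by rewrite -!mulmxA -PE pE !fK.
by rewrite -pE PE -!mulmxA YX mulmx1 YX mulmx1.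
Qed.

Lemma splits_similar (A : pzSemiRingType) m (P Q U V : 'M[A]_m) :
  V *m U = 1%:M -> P = U *m Q *m V -> splits Q -> splits P.
Proof.
move=> VU -> [r [X [Y [-> YX]]]]; exists r, (U *m X), (Y *m V).
by rewrite !mulmxA; split=> //; rewrite -(mulmxA Y) VU mulmx1.
Qed.

Definition intertwiner (A : pzRingType) m (P Q : 'M[A]_m) :=
  P *m Q + (1%:M - P) *m (1%:M - Q).

Lemma intertwiner_idem (A : pzRingType) m (P : 'M[A]_m) :
  P *m P = P -> intertwiner P P = 1%:M.
Proof.
move=> PP; rewrite /intertwiner mulmxBr mulmx1 (mulmxBl _ _ P) mul1mx PP.
by rewrite subrr subr0 addrC subrK.
Qed.

(** For idempotents, P W and W Q both equal P Q. As [d] inverts the determinant, [d *: \adj W] is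
    the inverse of W, hence P = W Q W^-1. *)
Lemma splits_intertwined (A : comPzRingType) m (P Q : 'M[A]_m) (d : A) :
  P *m P = P -> Q *m Q = Q -> d * \det (intertwiner P Q) = 1 ->
  splits Q -> splits P.
Proof.
move=> PP QQ dW; set W := intertwiner P Q in dW *.
have PW : P *m W = W *m Q.
  rewrite [LHS]mulmxDr [RHS]mulmxDl !mulmxA (mulmxBr P) mulmx1 PP subrr mul0mx.
  by rewrite addr0 -!mulmxA (mulmxBl _ _ Q) mul1mx QQ subrr mulmx0 addr0.
apply: (@splits_similar _ _ _ _ W (d *: \adj W)).
  by rewrite -scalemxAl mul_adj_mx scale_scalar_mx dW.
rewrite -PW -scalemxAr -mulmxA mul_mx_adj scalemxAr scale_scalar_mx.
by rewrite dW mulmx1.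
Qed.

(** In the rank factorization P = X Y, idempotence reads X (Y X) Y = X Y. Both factors have full
    rank, so X cancels on the left and Y on the right, leaving Y X = 1. *)
Lemma splits_field (F : fieldType) m (P : 'M[F]_m) : P *m P = P -> splits P.
Proof.
move=> PP; exists (\rank P), (col_base P), (row_base P).
split; first by rewrite mulmx_base.
apply: (row_full_inj (col_base_full P)).
apply: (row_free_inj (row_base_free P)).
by rewrite /= mulmx1 mulmxA mulmx_base -mulmxA mulmx_base PP.
Qed.

Lemma splits_map (A B : pzSemiRingType) (f : {rmorphism A -> B}) m
    (P : 'M[A]_m) :
  splits P -> splits (map_mx f P).
Proof.
move=> [r [X [Y [-> YX]]]]; exists r, (map_mx f X), (map_mx f Y).
by rewrite -!map_mxM YX map_mx1.
Qed.

(** * Differentiability up to order N, by recursion on ordered partials *)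

Section Smooth.
Variables (R : realType) (n : nat).
Local Notation C := (Cplx R).
Implicit Types (h : 'rV[C]_n -> C) (f : cpolydisc R n -> C).

(* Applying the partials with non-increasing indices, as [multi_partial] does,
   avoids the symmetry of mixed derivatives. *)
Fixpoint smooth (N m : nat) h : Prop :=
  extends_in_algebra h /\
  if N is N'.+1 then
    forall j : 'I_n, (j <= m)%N -> smooth N' j (partial j h)
  else True.

Lemma smooth_extends N m h : smooth N m h -> extends_in_algebra h.
Proof. by case: N => [|N] []. Qed.

Lemma smooth_le N m N' m' h : (N' <= N)%N -> (m' <= m)%N ->
  smooth N m h -> smooth N' m' h.
Proof.
elim: N' N m m' h => [|N' IH] [|N] m m' h //= NN mm [Eh Sh]; split=> // j jm.
by apply: (IH N j) => //; apply: Sh; exact: leq_trans mm.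
Qed.

Lemma eq_smooth N m g h : (forall z, polydisc R n z -> g z = h z) ->
  smooth N m g -> smooth N m h.
Proof.
elim: N m g h => [|N IH] m g h gh [Eg Sg].
  by split; [exact: extends_eq gh Eg|].
split; first exact: extends_eq gh Eg.
by move=> j jm; apply: IH (Sg j jm); exact: eq_partial.
Qed.

Lemma smooth_cst N m c : smooth N m (cst c).
Proof.
elim: N m c => [|N IH] m c; split; try exact: extends_cst; first by [].
move=> j _; suff -> : partial j (cst c) = cst 0 by [].
by apply/funext => z; exact: derive_cst.
Qed.

Lemma smoothB N m g h : smooth N m g -> smooth N m h -> smooth N m (g - h).
Proof.
elim: N m g h => [|N IH] m g h [Eg Sg] [Eh Sh]; split;
  try exact: extendsB Eg Eh.
  by [].
move=> j jm; apply: eq_smooth (IH _ _ _ (Sg j jm) (Sh j jm)).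
by apply: partialB; exact: extends_diff.
Qed.

Lemma smoothD N m g h : smooth N m g -> smooth N m h -> smooth N m (g + h).
Proof.
move=> Sg Sh; have -> : g + h = g - (cst 0 - h).
  by apply/funext => z; rewrite !fctE sub0r opprK.
by do 2?apply: smoothB => //; exact: smooth_cst.
Qed.

Lemma smoothM N m g h : smooth N m g -> smooth N m h -> smooth N m (g * h).
Proof.
elim: N m g h => [|N IH] m g h Sg Sh;
  have [Eg Eh] := (smooth_extends Sg, smooth_extends Sh).
  by split; [exact: extendsM|].
split; first exact: extendsM.
move=> j jm.
apply: eq_smooth (smoothD (IH _ _ _ _ (Sh.2 j jm)) (IH _ _ _ _ (Sg.2 j jm))).
- by apply: partialM; exact: extends_diff.
- by apply: smooth_le Sg.
- by apply: smooth_le Sh.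
Qed.

(** The right fold in [multi_partial] applies the partials of largest index first. If [a] vanishes
    beyond [j], an extra partial in [j] is therefore innermost already, and nothing has to be
    commuted. *)
Lemma multi_partial_add1 (a : 'I_n -> nat) (j : 'I_n) h :
  (forall i : 'I_n, (j < i)%N -> a i = 0%N) ->
  multi_partial (fun i => a i + (i == j))%N h = multi_partial a (partial j h).
Proof.
move=> a0; rewrite /multi_partial.
have : sorted ltn [seq val i | i <- enum 'I_n].
  by rewrite val_enum_ord iota_ltn_sorted.
have : j \in enum 'I_n by rewrite mem_enum.
elim: (enum 'I_n) => //= i s IH; rewrite inE => js si.
have /allP lt_i : all (ltn i) [seq val k | k <- s].
  by apply: order_path_min si; exact: ltn_trans.
have ss : sorted ltn [seq val k | k <- s] := path_sorted si.
case: (eqVneq j i) js => [ij _|ij /= js].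
  (* All exponents past [j] vanish, so the tail of the fold is the identity. *)
  have idf (b : 'I_n -> nat) h' : (forall k, k \in s -> b k = 0%N) ->
      foldr (fun k g => iter (b k) (partial k) g) h' s = h'.
    elim: (s) => //= k s' IH' b0; rewrite b0 ?mem_head// IH' // => l ls.
    by apply: b0; rewrite inE ls orbT.
  have gt k : k \in s -> (j < k)%N.
    by move=> ks; rewrite ij; apply: lt_i; exact: map_f.
  rewrite !idf; first by rewrite addn1 iterSr ij.
  - by move=> k /gt jk; rewrite a0.
  - by move=> k /gt jk; rewrite a0 // -val_eqE gtn_eqF.
by rewrite addn0 IH.
Qed.

(** The induction on N peels off the partial that is applied first, whose index [j] is the largest
    one with a nonzero exponent. The remaining indices are at most [j], which is the bound passed on
    by [smooth]. *)
Lemma smoothP N m h : smooth N m h <->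
  forall a : 'I_n -> nat, (forall i : 'I_n, (m < i)%N -> a i = 0%N) ->
    (\sum_i a i <= N)%N -> extends_in_algebra (multi_partial a h).
Proof.
have d1 (j : 'I_n) : (\sum_(i < n) (i == j) = 1)%N.
  by rewrite (bigD1 j) //= eqxx big1 // => i /negbTE ->.
have mp0 h' : multi_partial (fun=> 0%N : nat) h' = h'.
  by rewrite /multi_partial; elim: (enum _).
elim: N m h => [|N IH] m h /=.
  split=> [[Eh _] a _|E].
    rewrite leqn0 sum_nat_eq0 => /forallP a0.
    suff -> : a = fun=> 0%N by rewrite mp0.
    by apply/funext => i; apply/eqP; exact: a0.
  by split=> //; rewrite -(mp0 h); apply: E; rewrite // big1.
split=> [[Eh Sh] a am aN|E].
  have [/existsP[j0 aj0]|] := boolP [exists i, a i != 0%N]; last first.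
    rewrite negb_exists => /forallP a0; suff -> : a = fun=> 0%N by rewrite mp0.
    by apply/funext => i; apply/eqP; rewrite -[_ == _]negbK; exact: a0.
  have [j aj jmax] := @arg_maxnP _ j0 (fun i => a i != 0%N) val aj0.
  pose b i := (a i - (i == j))%N.
  have ab : a = fun i => (b i + (i == j))%N.
    by apply/funext => i; rewrite /b subnK //; case: eqP => // ->; rewrite lt0n.
  have agt (i : 'I_n) : (j < i)%N -> a i = 0%N.
    by move=> ji; apply/eqP/negPn/negP => /jmax; rewrite /= leqNgt ji.
  have bgt (i : 'I_n) : (j < i)%N -> b i = 0%N.
    by move=> ji; rewrite /b agt.
  rewrite ab multi_partial_add1 //.
  have jm : (j <= m)%N by rewrite leqNgt; apply/negP => /am; apply/eqP.
  have /IH := Sh j jm; apply=> //.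
  by move: aN; rewrite ab big_split /= d1 addn1.
split; first by rewrite -(mp0 h); apply: E; rewrite // big1.
move=> j jm; apply/IH => a am aN.
rewrite -multi_partial_add1 //; apply: E => [i mi|].
  have ji := leq_ltn_trans jm mi.
  by rewrite am // -val_eqE gtn_eqF.
by rewrite big_split /= d1 addn1.
Qed.

(** Every index in ['I_n] is below [n], so the starting bound [n] restricts nothing. *)
Lemma dN_algebraE N f : dN_algebra N f <->
  polydisc_algebra f /\ smooth N n (ext0 f).
Proof.
split=> -[Af Sf]; split=> //; first by apply/smoothP => a _; exact: Sf.
move=> a aN; have /smoothP := Sf; apply=> // i.
by rewrite ltnNge ltnW.
Qed.

End Smooth.

(** * Inverses of nowhere vanishing functions *)

Section Inverse.
Variables (R : realType) (n : nat).
Local Notation C := (Cplx R).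
Implicit Types (h : 'rV[C]_n -> C) (f : cpolydisc R n -> C).

Lemma ext0V f : ext0 (fun z => (f z)^-1) = fun z => (ext0 f z)^-1.
Proof.
apply/funext => z.
(* Off the closed polydisc both sides are 0, since [0^-1 = 0]. *)
by apply: (@ext0_ind _ _ (fun a b _ => a = b^-1) _ f f); rewrite ?invr0.
Qed.

Lemma ext0_neq0 f z : (forall w, f w != 0) -> polydisc R n z -> ext0 f z != 0.
Proof.
move=> f0 /subset_closure zD.
by rewrite -[z]/(val (SigSub (mem_set zD) : cpolydisc R n)) ext0E.
Qed.

Lemma polydisc_algebraV f : (forall z, f z != 0) ->
  polydisc_algebra f -> polydisc_algebra (fun z => (f z)^-1).
Proof.
move=> f0 [cf df]; split=> [z|z Dz].
  by apply: continuousV; [exact: f0|exact: cf].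
by rewrite ext0V; apply: differentiableV; [exact: df|exact: ext0_neq0].
Qed.

(** The partials of 1/f are -(1/f)^2 times those of f. To reach order N+1 it thus suffices to know
    1/f to order N, and the product rule concludes. *)
Lemma smoothV N m f : (forall z, f z != 0) -> polydisc_algebra f ->
  smooth N m (ext0 f) -> smooth N m (ext0 (fun z => (f z)^-1)).
Proof.
move=> f0 Af; have Eg : extends_in_algebra (ext0 (fun z => (f z)^-1)).
  by exists (fun z => (f z)^-1) => //; exact: polydisc_algebraV.
elim: N m => [|N IH] m Sf; split=> // j jm.
have Sg : smooth N j (ext0 (fun z => (f z)^-1)).
  by apply: IH; apply: smooth_le Sf.
have SgSf := smoothB (@smooth_cst R n N j 0)
  (smoothM (smoothM Sg Sg) (Sf.2 j jm)).
apply: eq_smooth SgSf.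
move=> z Dz; rewrite !ext0V /partial deriveV.
- by rewrite !fctE sub0r -exprVn expr2 /GRing.scale /= mulNr.
- exact: ext0_neq0.
- by apply: diff_derivable; exact: (Af.2 z Dz).
Qed.

Lemma dN_algebra_realV N f : (forall z, f z != 0) ->
  f \in dN_algebra_real R n N -> (fun z => (f z)^-1) \in dN_algebra_real R n N.
Proof.
move=> f0 /asboolP[/dN_algebraE[Af Sf] rf]; apply/asboolP; split.
  by apply/dN_algebraE; split; [exact: polydisc_algebraV|exact: smoothV].
by move=> z; rewrite rf fmorphV.
Qed.

End Inverse.

(** * Dilations of the closed polydisc *)

Section Dilation.
Variables (R : realType) (n : nat) (t : Cplx R).
Hypotheses (t0 : 0 <= t) (t1 : t <= 1).
Local Notation C := (Cplx R).
Implicit Types (h : 'rV[C]_n -> C) (f : cpolydisc R n -> C).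

Lemma polydisc_scale z : polydisc R n z -> polydisc R n (t *: z).
Proof.
move=> Dz j; rewrite mxE normrM ger0_norm //.
by apply: le_lt_trans (Dz j); rewrite ler_piMl.
Qed.

Lemma cpolydisc_scale z : cpolydisc R n z -> cpolydisc R n (t *: z).
Proof.
move=> cz B /(@scaler_continuous _ _ t z) /= /cz [w [Dw Bw]].
by exists (t *: w); split=> //; exact: polydisc_scale.
Qed.

Definition dilate (z : cpolydisc R n) : cpolydisc R n :=
  SigSub (mem_set (cpolydisc_scale (set_valP z))).

Lemma dilate_continuous : continuous dilate.
Proof.
apply: continuous_comp_initial => z.
apply: (@continuous_comp _ _ _ (set_val : cpolydisc R n -> _) ( *:%R t)).
  exact: initial_continuous.
exact: scaler_continuous.
Qed.

Lemma ext0_dilate f z : polydisc R n z ->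
  ext0 (f \o dilate) z = ext0 f (t *: z).
Proof.
move=> /subset_closure zD.
have -> : t *: z = val (dilate (SigSub (mem_set zD))) by [].
by rewrite -[z in LHS]/(val (SigSub (mem_set zD) : cpolydisc R n)) !ext0E.
Qed.

Lemma differentiable_dilate h z : polydisc R n z -> holomorphic h ->
  differentiable (fun w => h (t *: w)) z.
Proof.
move=> Dz dh; apply: (@differentiable_comp _ _ _ _ (fun w => t *: w) h) => //.
by apply: dh; exact: polydisc_scale.
Qed.

(** Chain rule: the inner map is linear, so the direction vector is scaled by [t], which then leaves
    the differential by linearity. *)
Lemma partial_dilate j h : holomorphic h -> forall z, polydisc R n z ->
  t * partial j h (t *: z) = partial j (fun w => h (t *: w)) z.
Proof.
move=> dh z Dz; have dht := dh _ (polydisc_scale Dz).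
have dt : differentiable ( *:%R t) z :=
  ex_diff (is_diff_def := is_diff_scaler t z).
have := diff_comp dt dht.
rewrite (diff_val (is_diff_def := is_diff_scaler t z)) => dc.
have := deriveE (delta_mx 0 j) (differentiable_comp dt dht).
have := congr1 (@^~ (delta_mx 0 j : 'rV[C]_n)) dc.
move=> /= -> E; rewrite /partial (deriveE _ dht).
by apply: etrans (esym E); rewrite linearZZ.
Qed.

Lemma polydisc_algebra_dilate f :
  polydisc_algebra f -> polydisc_algebra (f \o dilate).
Proof.
move=> [cf df]; split=> z.
  by apply: continuous_comp; [exact: dilate_continuous|exact: cf].
move=> Dz; apply: near_eq_differentiable (differentiable_dilate Dz df).
by apply: filterS (near_polydisc Dz) => w Dw; rewrite ext0_dilate.
Qed.

Lemma extends_dilate h :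
  extends_in_algebra h -> extends_in_algebra (fun w => h (t *: w)).
Proof.
move=> [g Ag hg]; exists (g \o dilate); first exact: polydisc_algebra_dilate.
by move=> z Dz; rewrite ext0_dilate // hg //; exact: polydisc_scale.
Qed.

Lemma smooth_dilate N m h : smooth N m h -> smooth N m (fun w => h (t *: w)).
Proof.
elim: N m h => [|N IH] m h [Eh Sh]; split;
  try exact: extends_dilate; first by [].
move=> j jm; have := smoothM (@smooth_cst R n N j t) (IH _ _ (Sh j jm)).
by apply: eq_smooth; apply: partial_dilate; exact: extends_diff.
Qed.

Lemma dN_algebra_real_dilate N f :
  f \in dN_algebra_real R n N -> f \o dilate \in dN_algebra_real R n N.
Proof.
move=> /asboolP[/dN_algebraE[Af Sf] rf]; apply/asboolP; split.
  apply/dN_algebraE; split; first exact: polydisc_algebra_dilate.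
  by apply: eq_smooth (smooth_dilate Sf) => z Dz; rewrite ext0_dilate.
(* The order of C makes [0 <= t] imply that [t] is real, so the dilation commutes with
   conjugation. *)
move=> z; rewrite [LHS]rf; congr ((f _)^*); apply: val_inj.
by apply/rowP => j; rewrite !mxE rmorphM /= (conj_Creal (ger0_real t0)).
Qed.

End Dilation.

(** * Compactness of the closed polydisc and uniform nonvanishing *)

Section Compactness.
Variables (R : realType) (n : nat).
Local Notation C := (Cplx R).

(** Balls over C have radii in C; this turns such a radius into a real number. *)
Lemma gt0_complexE (e : C) : 0 < e -> exists2 r : R, 0 < r & e = r%:C%C.
Proof.
case: e => a b; rewrite ltcE /= => /andP[/eqP -> a0].
by exists a.
Qed.

(** Carries compactness of a square in the real plane over to C. *)
Definition complex_of_pair (p : R * R) : C := Complex p.1 p.2.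

Lemma complex_of_pair_continuous : continuous complex_of_pair.
Proof.
move=> [a b] A /nbhs_ballP [e /gt0_complexE [r r0 ->] eA].
have r20 : 0 < r / 2 by rewrite divr_gt0.
exists (ball a (r / 2), ball b (r / 2)); first by split; exact: nbhsx_ballx.
move=> [c d] /= [ac bd]; apply: eA; move: ac bd.
rewrite -!ball_normE /ball_ /= => ac bd.
have -> : complex_of_pair (a, b) - complex_of_pair (c, d) =
          (a - c)%:C%C + 'i%C * (b - d)%:C%C :> R[i].
  exact: complexE.
have -> : r%:C%C = (r / 2)%:C%C + (r / 2)%:C%C :> R[i].
  by rewrite -rmorphD -splitr.
apply: le_lt_trans (ler_normD _ _) _.
have nR (x : R) : `|x%:C%C : R[i]| = `|x|%:C%C.
  by rewrite normc_def /= expr0n addr0 sqrtr_sqr.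
rewrite normrM !nR [X in X * _]normc_def /= expr0n add0r expr1n sqrtr1 mul1r.
by apply: ltrD; rewrite ltcR.
Qed.

(** A crude bound: some point of the open polydisc lies within distance 1 of z. *)
Lemma cpolydisc_norm_le2 z j : cpolydisc R n z -> `|z 0 j| <= 2.
Proof.
move=> /(_ _ (nbhsx_ballx z 1 ltr01)) [w [Dw [_ zw]]].
have := zw 0 j; rewrite -ball_normE /ball_ /= => zw1.
rewrite -[z 0 j](subrK (w 0 j)); apply: le_trans (ler_normD _ _) _.
by rewrite -[2]/(1 + 1); apply: lerD; apply: ltW.
Qed.

(** It is a closed subset of a product of copies of [Q], the compact set of complex numbers with
    real and imaginary parts in [-1, 1]. *)
Lemma compact_cpolydisc : compact (cpolydisc R n).
Proof.
pose Q := complex_of_pair @` (`[-1, 1] `*` `[-1, 1]).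
have cQ : compact [set z : 'rV[C]_n | forall j, Q (z ord0 j)].
  apply: (@rV_compact C n (fun=> Q)) => j; apply: continuous_compact.
    by apply: continuous_subspaceT; exact: complex_of_pair_continuous.
  by apply: compact_setX; exact: segment_compact.
apply: (subclosed_compact _ cQ); first exact: closed_closure.
(* As the product is closed, only points of the open polydisc need be placed in it; there |Re| and
   |Im| are bounded by the modulus. *)
have /closure_id -> : closed [set z : 'rV[C]_n | forall j, Q (z ord0 j)].
  by apply: compact_closed cQ; exact: norm_hausdorff.
apply: closureS => z Dz j; have := Dz j; case: (z 0 j) => a b.
rewrite normc_def ltcR /= => ab1.
exists (a, b) => //; split=> /=; rewrite in_itv /= -ler_norml.
  by apply: le_trans (ltW ab1); rewrite -sqrtr_sqr ler_wsqrtr // lerDl sqr_ge0.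
by apply: le_trans (ltW ab1); rewrite -sqrtr_sqr ler_wsqrtr // lerDr sqr_ge0.
Qed.

Lemma near_infty_invS_lt (e : C) : 0 < e -> \forall K \near \oo, K.+1%:R^-1 < e.
Proof.
move=> /gt0_complexE [r r0 ->].
have := near_infty_natSinv_lt (PosNum r0); apply: filterS => K /=.
by rewrite -ltcR fmorphV /= rmorph_nat.
Qed.

(** Each diagonal point has a product neighbourhood on which F does not vanish; compactness makes
    its size uniform. *)
Lemma nonzero_near_diagonal (F : cpolydisc R n * cpolydisc R n -> C) :
  continuous F -> (forall z, F (z, z) != 0) ->
  exists K : nat, forall z w : cpolydisc R n,
    ball (val z) (K.+1%:R^-1 : C) (val w) -> F (z, w) != 0.
Proof.
move=> cF F0; have /compact_near_coveringP cK := compact_cpolydisc.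
(* The covering criterion ranges over points [x] of the ambient space, so [z] is tied to [x] by an
   equation. *)
pose P (K : nat) (x : 'rV[C]_n) := forall z w : cpolydisc R n,
    val z = x -> ball x (K.+1%:R^-1 : C) (val w) -> F (z, w) != 0.
have [|K _ KP] := cK nat \oo P _; last first.
  exists K => z w; apply: (KP K (leqnn K) (val z) (set_valP z)) => //.
move=> x xD; pose z0 : cpolydisc R n := SigSub (mem_set xD).
have := cvgr_neq0 _ (cF (z0, z0)) (F0 z0).
move=> [[A B] /= [[_ [[U oU <-]] /= Ux UA] [_ [[V oV <-]] /= Vx VB]] AB].
have xW : nbhs x (U `&` V) by apply: filterI; apply: open_nbhs_nbhs.
have /nbhs_ballP [e e0 eUV] := xW.
have e20 : 0 < e / 2 by rewrite divr_gt0.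
(* With [z] and the allowed distance from [z] to [w] both within e/2, [w] stays in the ball of
   radius e around [x]. *)
exists (ball x (e / 2), [set K : nat | K.+1%:R^-1 < e / 2]).
  by split; [exact: (@nbhsx_ballx C _ x _ e20)|exact: near_infty_invS_lt].
move=> [y K] /= [xy Ke] z w zy yw.
apply: (AB (z, w)); split=> /=.
  apply: UA => /=.
  have /eUV [//] : ball x e (val z).
  rewrite zy; apply: le_ball xy.
  by rewrite ler_piMr ?(ltW e0) // invf_le1 // ler1n.
apply: VB => /=.
have /eUV [//] : ball x e (val w).
apply: (ball_split xy); apply: le_ball yw; exact: ltW.
Qed.

End Compactness.

(** * Evaluation, constants and dilation on the ring *)

Section Ring.
Variables (R : realType) (n N : nat).
Local Notation C := (Cplx R).
Local Notation B := (dN_ring R n N).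
Implicit Types (b : B) (z w : cpolydisc R n) (a : R).

Definition dN_eval z b : C := b z.

Lemma dN_eval_zmod_morphism z : zmod_morphism (dN_eval z).
Proof. by move=> b c; reflexivity. Qed.

Lemma dN_eval_monoid_morphism z : monoid_morphism (dN_eval z).
Proof.
by split=> [|b c]; reflexivity.
Qed.

HB.instance Definition _ z :=
  GRing.isZmodMorphism.Build B C (dN_eval z) (dN_eval_zmod_morphism z).
HB.instance Definition _ z :=
  GRing.isMonoidMorphism.Build B C (dN_eval z) (dN_eval_monoid_morphism z).

Lemma dN_eval_inj b c : (forall z, dN_eval z b = dN_eval z c) -> b = c.
Proof. by move=> bc; apply: val_inj; apply/funext => z; exact: bc. Qed.

(** Reduces matrix identities over the ring to identities over the field C at each point. *)
Lemma dN_eval_mx_inj m p (X Y : 'M[B]_(m, p)) :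
  (forall z, map_mx (dN_eval z) X = map_mx (dN_eval z) Y) -> X = Y.
Proof.
move=> XY; apply/matrixP => i j; apply: dN_eval_inj => z.
by have /matrixP/(_ i j) := XY z; rewrite !mxE.
Qed.

Lemma dN_eval_continuous b : continuous (dN_eval ^~ b).
Proof. by have /asboolP[[[]]] := dN_funP b. Qed.

Lemma nonvanishing_invertible b : (forall z, dN_eval z b != 0) ->
  exists c, c * b = 1.
Proof.
move=> b0; exists (DNRing (dN_algebra_realV b0 (dN_funP b))).
by apply: dN_eval_inj => z; rewrite rmorphM rmorph1 /= mulVf.
Qed.

Lemma dN_algebra_real_cst a : cst (a%:C%C : C) \in dN_algebra_real R n N.
Proof.
apply/asboolP; split; last by move=> z; rewrite conj_Creal // complex_real.
apply/dN_algebraE; split; first exact: polydisc_algebra_cst.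
by apply: eq_smooth (@smooth_cst R n N n a%:C%C) => z Dz; rewrite ext0_cst.
Qed.

Definition dN_const a : B := DNRing (dN_algebra_real_cst a).

Lemma dN_const_zmod_morphism : zmod_morphism dN_const.
Proof.
move=> a c; apply: dN_eval_inj => z.
by rewrite rmorphB /= /dN_eval /= rmorphB.
Qed.

Lemma dN_const_monoid_morphism : monoid_morphism dN_const.
Proof.
split=> [|a c]; apply: dN_eval_inj => z; rewrite ?rmorphM ?rmorph1 //=.
by rewrite /dN_eval /= rmorphM.
Qed.

HB.instance Definition _ :=
  GRing.isZmodMorphism.Build R B dN_const dN_const_zmod_morphism.
HB.instance Definition _ :=
  GRing.isMonoidMorphism.Build R B dN_const dN_const_monoid_morphism.

Definition dil (t : C) (t0 : 0 <= t) (t1 : t <= 1) b : B :=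
  DNRing (dN_algebra_real_dilate t0 t1 (dN_funP b)).

Lemma cpolydisc0 : cpolydisc R n 0.
Proof. by apply: subset_closure => j; rewrite mxE normr0. Qed.

Definition origin : cpolydisc R n := SigSub (mem_set cpolydisc0).

(** Conjugation fixes the origin, so real symmetry forces a real value there; P_0 thus comes from a
    matrix over the field [R]. *)
Lemma dN_eval_origin b :
  dN_eval origin b = (complex.Re (dN_eval origin b))%:C%C.
Proof.
apply/esym/RRe_real/CrealP.
have /asboolP[_ /(_ origin) rb] := dN_funP b.
rewrite /dN_eval [RHS]rb; congr ((dN_fun b _)^*).
by apply: val_inj; apply/rowP => j; rewrite !mxE conjC0.
Qed.

Lemma dN_const_inj : injective dN_const.
Proof. by move=> a c /(congr1 (dN_eval origin)) /complexI. Qed.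

Section Dilate.
Variables (t : C) (t0 : 0 <= t) (t1 : t <= 1).

Lemma dN_eval_dil m p (X : 'M[B]_(m, p)) z :
  map_mx (dN_eval z) (map_mx (dil t0 t1) X) =
  map_mx (dN_eval (dilate t0 t1 z)) X.
Proof. by apply/matrixP => i j; rewrite !mxE. Qed.

Lemma dil_idem m (P : 'M[B]_m) : P *m P = P ->
  map_mx (dil t0 t1) P *m map_mx (dil t0 t1) P = map_mx (dil t0 t1) P.
Proof.
move=> PP; apply: dN_eval_mx_inj => z.
by rewrite map_mxM dN_eval_dil -map_mxM PP.
Qed.

(** P_0 is the image under [dN_const] of a real matrix. Injectivity of [dN_const] makes that matrix
    idempotent, and its splitting over [R] is mapped back to the ring. *)
Lemma splits_dil0 m (P : 'M[B]_m) : t = 0 -> P *m P = P ->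
  splits (map_mx (dil t0 t1) P).
Proof.
move=> tE PP; pose P0 := map_mx (fun b => complex.Re (dN_eval origin b)) P.
have PE : map_mx (dil t0 t1) P = map_mx dN_const P0.
  apply: dN_eval_mx_inj => z; rewrite dN_eval_dil; apply/matrixP => i j.
  rewrite !mxE.
  have -> : dilate t0 t1 z = origin by apply: val_inj; rewrite /= tE scale0r.
  exact: dN_eval_origin.
rewrite PE; apply: splits_map; apply: splits_field.
have := dil_idem PP; rewrite PE -map_mxM => /matrixP E.
by apply/matrixP => i j; have := E i j; rewrite !mxE => /dN_const_inj.
Qed.

End Dilate.

Lemma splits_dil_near m (P : 'M[B]_m) (s t : C) (s0 : 0 <= s) (s1 : s <= 1)
    (t0 : 0 <= t) (t1 : t <= 1) :
  (forall z, \det (intertwiner (map_mx (dN_eval (dilate s0 s1 z)) P)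
                               (map_mx (dN_eval (dilate t0 t1 z)) P)) != 0) ->
  P *m P = P -> splits (map_mx (dil t0 t1) P) -> splits (map_mx (dil s0 s1) P).
Proof.
move=> W0 PP.
have [z|d dW] := @nonvanishing_invertible
  (\det (intertwiner (map_mx (dil s0 s1) P) (map_mx (dil t0 t1) P))).
  rewrite -det_map_mx /intertwiner map_mxD !map_mxM !map_mxB !map_mx1.
  by rewrite !dN_eval_dil; exact: W0.
by apply: splits_intertwined dW; exact: dil_idem.
Qed.

End Ring.

(** * Continuity of determinants of matrix-valued functions *)

Section ContinuousMatrix.
Variables (K : numFieldType) (T : topologicalType).

Lemma continuous_sum I (r : seq I) (Q : pred I) (F : I -> T -> K) :
  (forall i, Q i -> continuous (F i)) ->
  continuous (fun x => \sum_(i <- r | Q i) F i x).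
Proof. by apply: continuous_big; exact: add_continuous. Qed.

Lemma continuous_prod I (r : seq I) (Q : pred I) (F : I -> T -> K) :
  (forall i, Q i -> continuous (F i)) ->
  continuous (fun x => \prod_(i <- r | Q i) F i x).
Proof. by apply: continuous_big; exact: mul_continuous. Qed.

Lemma continuous_det m (X : T -> 'M[K]_m) :
  (forall i j, continuous (fun x => X x i j)) ->
  continuous (fun x => \det (X x)).
Proof.
move=> cX; apply: continuous_sum => s _ x.
apply: cvgM; first exact: cvg_cst.
by apply: continuous_prod => i _; exact: cX.
Qed.

Lemma continuous_mulmx (m p q : nat) (X : T -> 'M[K]_(m, p))
    (Y : T -> 'M[K]_(p, q)) :
  (forall i j, continuous (fun x => X x i j)) ->
  (forall i j, continuous (fun x => Y x i j)) ->
  forall i j, continuous (fun x => (X x *m Y x) i j).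
Proof.
move=> cX cY i j.
have -> : (fun x => (X x *m Y x) i j) = fun x => \sum_k X x i k * Y x k j.
  by apply/funext => x; rewrite mxE.
apply: continuous_sum => k _ x; apply: cvgM; [exact: cX|exact: cY].
Qed.

Lemma continuous_det_intertwiner m (X Y : T -> 'M[K]_m) :
  (forall i j, continuous (fun x => X x i j)) ->
  (forall i j, continuous (fun x => Y x i j)) ->
  continuous (fun x => \det (intertwiner (X x) (Y x))).
Proof.
move=> cX cY; apply: continuous_det => i j.
have c1 (Z : T -> 'M[K]_m) : (forall i j, continuous (fun x => Z x i j)) ->
    forall i j, continuous (fun x => (1%:M - Z x) i j).
  move=> cZ k l.
  have -> : (fun x => (1%:M - Z x) k l) =
      fun x => (1%:M : 'M[K]_m) k l - Z x k l.
    by apply/funext => x; rewrite !mxE.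
  by move=> x; apply: cvgB; [exact: cvg_cst|exact: cZ].
have -> : (fun x => intertwiner (X x) (Y x) i j) = fun x =>
    (X x *m Y x) i j + ((1%:M - X x) *m (1%:M - Y x)) i j.
  by apply/funext => x; rewrite [LHS]mxE.
by move=> x; apply: cvgD; apply: continuous_mulmx => //; exact: c1.
Qed.

End ContinuousMatrix.

(** * The finite chain of dilations from P_0 to P_1 *)

Theorem theorem1p3 (R : realType) (n N : nat) (hn : (0 < n)%N) (hN : (0 < N)%N) :
  projective_free (dN_ring R n N).
Proof.
apply: splits_projective_free => m P PP; pose C := Cplx R.
pose Pz z := map_mx (dN_eval z) P.
have cP i j : continuous (fun z => Pz z i j).
  have -> : (fun z => Pz z i j) = (dN_eval (R := R) (N := N))^~ (P i j).
    by apply/funext => z; rewrite mxE.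
  exact: dN_eval_continuous.
(* On the diagonal the intertwiner is the identity, of determinant 1; [K] gives a uniform distance
   within which the determinant stays nonzero. *)
have [||K nz] := @nonzero_near_diagonal R n
  (fun p => \det (intertwiner (Pz p.1) (Pz p.2))).
- apply: continuous_det_intertwiner => i j p.
    apply: (@continuous_comp _ _ _ fst (fun z => Pz z i j)); last exact: cP.
    exact: cvg_fst.
  apply: (@continuous_comp _ _ _ snd (fun z => Pz z i j)); last exact: cP.
  exact: cvg_snd.
- by move=> z; rewrite intertwiner_idem ?det1 ?oner_neq0 // -map_mxM PP.
(* With steps 1/M, successive dilates of z differ in each coordinate by at most 2/M = 1/(K+2),
   strictly less than 1/(K+1). *)
pose M := (2 * K.+2)%N.
have M0 : (0 : C) < M%:R by rewrite ltr0n.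
(* Quantifying over [t] and the proofs of its bounds frees the induction from the particular proofs
   carried by [dil]. *)
have step k : (k <= M)%N -> forall (t : C) (t0 : 0 <= t) (t1 : t <= 1),
    t = k%:R / M%:R -> splits (map_mx (dil t0 t1) P).
  elim: k => [_ t t0 t1 tE|k IH kM s s0 s1 sE].
    by apply: splits_dil0 => //; rewrite tE mul0r.
  pose t : C := k%:R / M%:R.
  have t0 : 0 <= t by rewrite divr_ge0 // ?ler0n // ltW.
  have st : s - t = M%:R^-1 by rewrite sE /t -mulrBl -natrB // subSnn mul1r.
  have t1 : t <= 1.
    by apply: le_trans s1; rewrite -subr_ge0 st invr_ge0 ltW.
  apply: (@splits_dil_near _ _ _ _ _ s t s0 s1 t0 t1) => //; last first.
    exact: IH (ltnW kM) _ _ _ erefl.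
  move=> z; apply: nz; split; first by rewrite invr_gt0 ltr0n.
  move=> i j; rewrite -ball_normE /ball_ /= !mxE ord1 -mulrBl normrM st.
  have zj : `|val z 0 j| <= 2 by apply: cpolydisc_norm_le2; exact: set_valP.
  apply: (@le_lt_trans _ _ (M%:R^-1 * 2)).
    by rewrite ger0_norm ?invr_ge0 ?(ltW M0) // ler_pM2l // invr_gt0.
  rewrite /M natrM invfM mulrC mulrA divff ?mul1r ?pnatr_eq0 //.
  by rewrite ltf_pV2 ?posrE ?ltr0n // ltr_nat.
have := step M (leqnn M) 1 ler01 (lexx 1) (esym (divff (lt0r_neq0 M0))).
(* At k = M the factor is 1, and dilation by 1 is the identity. *)
suff -> : map_mx (dil ler01 (lexx 1)) P = P by [].
apply: dN_eval_mx_inj => z; rewrite dN_eval_dil; congr (map_mx (dN_eval _) P).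
by apply: val_inj; rewrite /= scale1r.
Qed.
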